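(* Let $X$ be a real Hilbert space, let $A : X \rightrightarrows X$ be maximally monotone, let $w \in X$ and $\gamma \in \,]0,1[$. Suppose that $A$ is an affine relation. Then the following hold: (i) $J_{A_\gamma}$ is affine. (ii) $A_\gamma$ is an affine relation.
   Context: For a set-valued operator $C : X \rightrightarrows X$, the resolvent is $J_C = (\mathrm{Id} + C)^{-1}$; when $C$ is maximally monotone, $J_C$ is a single-valued map defined on all of $X$. The operator $C$ is called an affine relation if its graph $\{(x,u) \in X \times X : u \in C(x)\}$ is an affine subspace of $X \times X$. A single-valued map $F : X \to X$ is affine if $F(tx + (1-t)y) = tF(x) + (1-t)F(y)$ for all $x,y \in X$ and $t \in \mathbb{R}$. For $w \in X$ and $\gamma \in \,]0,1[$, the operator $A_\gamma : X \rightrightarrows X$ is defined by $$A_\gamma(x) = A\big(\gamma^{-1}(x - (1-\gamma)w)\big) + \gamma^{-1}(1-\gamma)(x - w).$$ It is known that $A_\gamma$ is maximally monotone and that $J_{A_\gamma} = \gamma J_A + (1-\gamma) w$. *)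

(* Defs.v *)
From mathcomp Require Import all_boot all_order all_algebra.
From mathcomp Require Import all_classical all_reals all_analysis.

Set Implicit Arguments.
Unset Strict Implicit.
Unset Printing Implicit Defensive.

Import Order.TTheory GRing.Theory Num.Theory.
Import numFieldNormedType.Exports.

Local Open Scope classical_set_scope.
Local Open Scope ring_scope.

(* A real Hilbert space is a complete normed module over a realType together
   with a real inner product (MathComp's positive definite symmetric bilinear
   forms, [{dot X for idfun}]) which induces its norm. *)
Definition induces_norm (R : realType) (X : normedModType R)
    (ip : {dot X for idfun}) : Prop :=
  forall x : X, ip x x = `|x| ^+ 2.

(* A set-valued operator from X to X is a function [X -> set X]. *)

Definition graph_of (X : Type) (C : X -> set X) : set (X * X) :=
  [set z | C z.1 z.2].

Definition inverse_op (X : Type) (C : X -> set X) : X -> set X :=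
  fun u => [set x | C x u].

Definition monotone_op (R : realType) (X : normedModType R)
    (ip : {dot X for idfun}) (C : X -> set X) : Prop :=
  forall x u y v, C x u -> C y v -> 0 <= ip (x - y) (u - v).

Definition maximally_monotone (R : realType) (X : normedModType R)
    (ip : {dot X for idfun}) (C : X -> set X) : Prop :=
  monotone_op ip C /\
  forall B : X -> set X, monotone_op ip B ->
    graph_of C `<=` graph_of B -> graph_of B = graph_of C.

Definition id_plus (X : zmodType) (C : X -> set X) : X -> set X :=
  fun x => [set x + u | u in C x].

Definition resolvent (X : zmodType) (C : X -> set X) : X -> set X :=
  inverse_op (id_plus C).

(* Affine subspaces are nonempty. *)
Definition affine_subspace (R : realType) (V : lmodType R) (S : set V) : Prop :=
  S !=set0 /\
  forall (t : R) (x y : V), S x -> S y -> S (t *: x + (1 - t) *: y).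

Definition affine_relation (R : realType) (X : lmodType R)
    (C : X -> set X) : Prop :=
  affine_subspace (graph_of C : set (X * X)%type).

Definition affine_map (R : realType) (X : lmodType R) (F : X -> X) : Prop :=
  forall (x y : X) (t : R), F (t *: x + (1 - t) *: y) = t *: F x + (1 - t) *: F y.

(* [C], as a set-valued operator, is single-valued with full domain, and the
   map [X -> X] it defines is affine. *)
Definition is_affine_map_op (R : realType) (X : lmodType R)
    (C : X -> set X) : Prop :=
  exists F : X -> X, (forall x, C x = [set F x]) /\ affine_map F.

Definition A_gamma (R : realType) (X : lmodType R)
    (A : X -> set X) (w : X) (gamma : R) : X -> set X :=
  fun x => [set u + (gamma^-1 * (1 - gamma)) *: (x - w)
           | u in A (gamma^-1 *: (x - (1 - gamma) *: w))].

(* Main.v *)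
(* The map [(y, v) |-> (gamma y + (1 - gamma) w, v + (1 - gamma) (y - w))] is an
   affine bijection of [X * X] sending the graph of [A] onto that of [A_gamma],
   and it preserves the sum of the two coordinates. Hence [A_gamma] is an affine
   relation and its resolvent is [gamma J_A + (1 - gamma) w], provided that [J_A]
   is everywhere defined, which is Minty's theorem for affine relations. *)
Require Import Defs.
From mathcomp Require Import all_boot all_order all_algebra.
From mathcomp Require Import all_classical all_reals all_analysis.
From mathcomp Require Import ring lra.

Set Implicit Arguments.
Unset Strict Implicit.
Unset Printing Implicit Defensive.

Import Order.TTheory GRing.Theory Num.Theory.
Import numFieldNormedType.Exports.

Local Open Scope classical_set_scope.
Local Open Scope ring_scope.

Lemma innerC (R : realType) (X : normedModType R) (ip : {dot X for idfun})
    (x y : X) : ip x y = ip y x.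
Proof. by rewrite hermC /= expr0 mul1r. Qed.

Lemma sqr_normD (R : realType) (X : normedModType R) (ip : {dot X for idfun})
    (hip : induces_norm ip) (x y : X) :
  `|x + y| ^+ 2 = `|x| ^+ 2 + 2 * ip x y + `|y| ^+ 2.
Proof.
by rewrite -!hip linearDl !linearDr /= (innerC ip y x); ring.
Qed.

Lemma sqr_normB (R : realType) (X : normedModType R) (ip : {dot X for idfun})
    (hip : induces_norm ip) (x y : X) :
  `|x - y| ^+ 2 = `|x| ^+ 2 - 2 * ip x y + `|y| ^+ 2.
Proof. by rewrite (sqr_normD hip) linearNr normrN; ring. Qed.

(** Polarization expresses [ip] through the norm, which is continuous. *)
Lemma cvg_inner (R : realType) (X : normedModType R) (ip : {dot X for idfun})
    (hip : induces_norm ip) (f g : nat -> X) (a b : X) :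
  f @ \oo --> a -> g @ \oo --> b -> (fun n => ip (f n) (g n)) @ \oo --> ip a b.
Proof.
move=> fa gb.
have polar x y : ip x y = 4^-1 * (`|x + y| ^+ 2 - `|x - y| ^+ 2).
  by rewrite (sqr_normD hip) (sqr_normB hip); field.
under eq_fun do rewrite polar.
rewrite polar; apply: cvgMl_tmp; apply: cvgB; rewrite expr2;
  under eq_fun do rewrite expr2; apply: cvgM; apply: cvg_norm;
  by [apply: cvgD | apply: cvgB].
Qed.

(** With [ip r k = t * (|k|^2 + 1)], expanding the inequality at this [t] leaves
    [t^2 * (|k|^2 + 2) <= 0]. *)
Lemma sqr_norm_min_orthogonal (R : realType) (X : normedModType R)
    (ip : {dot X for idfun}) (hip : induces_norm ip) (r k : X) :
  (forall t : R, `|r| ^+ 2 <= `|r - t *: k| ^+ 2) -> ip r k = 0.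
Proof.
move=> rmin; have k0 := sqr_ge0 `|k|.
have k1 : `|k| ^+ 2 + 1 != 0 by rewrite gt_eqF//; lra.
(* The minimizer would be [ip r k / `|k| ^+ 2]; adding 1 avoids the case [k = 0]. *)
have [t tE] : exists t, ip r k = t * (`|k| ^+ 2 + 1).
  by exists (ip r k / (`|k| ^+ 2 + 1)); rewrite divfK.
have := rmin t; rewrite (sqr_normB hip) linearZr_LR /= normrZ exprMn.
rewrite real_normK ?num_real// tE => H.
have t0 : t ^+ 2 <= 0 by nra.
have /eqP : t ^+ 2 = 0 by apply/eqP; rewrite eq_le t0 sqr_ge0.
by rewrite sqrf_eq0 => /eqP ->; rewrite mul0r.
Qed.

Lemma cvg_of_sqr_norm_le (R : realType) (X : completeNormedModType R)
    (u : nat -> X) :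
  (forall m n, (m <= n)%N -> `|u m - u n| ^+ 2 <= 4 / m.+1%:R) -> cvgn u.
Proof.
move=> hu; apply: cauchy_cvg; apply: cauchy_exP => e e0.
have e4 : 0 < e ^+ 2 / 4 by rewrite divr_gt0// exprn_gt0.
have [N _ /(_ N (leqnn N)) /= hN] := near_infty_natSinv_lt (PosNum e4).
exists (u N); exists N => // n /= Nn.
rewrite -ball_normE /= -(@ltr_pXn2r _ 2)// ?nnegrE ?(ltW e0)//.
by apply: le_lt_trans (hu _ _ Nn) _; rewrite mulrC -ltr_pdivlMr.
Qed.

(** Monotonicity makes the cross term of the expanded square nonnegative. Hence the sum [x + u]
    controls both coordinates of a point of the graph. *)
Lemma sqr_norm_le_sum (R : realType) (X : normedModType R)
    (ip : {dot X for idfun}) (hip : induces_norm ip) (A : X -> set X)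
    (hA : monotone_op ip A) (x u y v : X) : A x u -> A y v ->
  `|x - y| ^+ 2 + `|u - v| ^+ 2 <= `|(x + u) - (y + v)| ^+ 2.
Proof.
move=> xu yv; have := hA _ _ _ _ xu yv.
by rewrite opprD addrACA (sqr_normD hip (x - y)); lra.
Qed.

(** Adjoining [(x, u)] to the graph keeps it monotone, so by maximality it was already there. *)
Lemma maximally_monotone_mem (R : realType) (X : normedModType R)
    (ip : {dot X for idfun}) (A : X -> set X) (hA : maximally_monotone ip A)
    (x u : X) : (forall y v, A y v -> 0 <= ip (x - y) (u - v)) -> A x u.
Proof.
move=> xuA; case: hA => mA maxA.
pose B y := [set v | A y v \/ (y = x /\ v = u)].
have mB : monotone_op ip B.
  move=> y v z s [yv|[-> ->]] [zs|[-> ->]]; first exact: mA.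
  - by rewrite -opprB -(opprB u) linearNl linearNr opprK; exact: xuA.
  - exact: xuA.
  - by rewrite subrr linear0l.
have BA := maxA B mB (fun z Az => or_introl Az).
have : graph_of B (x, u) by right.
by rewrite BA.
Qed.

Lemma affine_relation_comb (R : realType) (X : lmodType R) (A : X -> set X)
    (hA : affine_relation A) (t : R) (x u y v : X) : A x u -> A y v ->
  A (t *: x + (1 - t) *: y) (t *: u + (1 - t) *: v).
Proof. by move=> xu yv; exact: (hA.2 t (x, u) (y, v)). Qed.

(* Minty's theorem for affine relations. Minimize the distance from [p] to the
   range of [Id + A]; the residual [r] at a minimizer [(x, u)] is orthogonal to
   the range, so that [(x + r, u + r)] is monotonically related to [A].
   Maximality puts it in the graph, and orthogonality then gives [r = 0]. *)
Lemma affine_minty (R : realType) (X : completeNormedModType R)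
    (ip : {dot X for idfun}) (hip : induces_norm ip)
    (A : X -> set X) (hA : maximally_monotone ip A)
    (hAaff : affine_relation A) (p : X) : exists x, A x (p - x).
Proof.
have mA := hA.1.
pose d (z : X * X) : R := `|p - (z.1 + z.2)| ^+ 2.
pose S := [set d z | z in graph_of A].
have lbS : has_lbound S by exists 0 => _ [z _ <-]; exact: sqr_ge0.
have infS : has_inf S.
  by split => //; have [[z Az] _] := hAaff; exists (d z), z.
have minS x u : A x u -> inf S <= d (x, u).
  by move=> xu; apply: ge_inf => //; exists (x, u).
have /choice[z zP] (n : nat) :
    exists z, A z.1 z.2 /\ d z < inf S + n.+1%:R^-1.
  have [|_ [z Az <-] dz] := @inf_adherent _ S n.+1%:R^-1 _ infS.
    by rewrite invr_gt0.
  by exists z.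
have zA n := (zP n).1.
have zd n := (zP n).2.
(* Parallelogram law at the midpoint of [z m] and [z n]. *)
have z_cauchy m n : (m <= n)%N ->
    `|((z m).1 + (z m).2) - ((z n).1 + (z n).2)| ^+ 2 <= 4 / m.+1%:R.
  move=> mn; set a := (z m).1 + (z m).2; set b := (z n).1 + (z n).2.
  have := minS _ _ (affine_relation_comb hAaff 2^-1 (zA m) (zA n)).
  rewrite /d /= addrACA -!scalerDr -/a -/b.
  have -> : p - (2^-1 *: a + (1 - 2^-1) *: b) = 2^-1 *: ((p - a) + (p - b)).
    have -> : 1 - 2^-1 = 2^-1 :> R by field.
    rewrite -scalerDr (addrACA p) -opprD scalerBr; congr (_ - _).
    by rewrite scalerDr -scalerDl (_ : 2^-1 + 2^-1 = 1) ?scale1r//; field.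
  rewrite normrZ exprMn ger0_norm// (sqr_normD hip).
  have -> : a - b = (p - b) - (p - a) by rewrite opprB [RHS]addrC subrKA.
  rewrite (sqr_normB hip (p - b)) (innerC ip (p - b)).
  (* The midpoint has [d] at least [inf S], so [|a - b|^2] is at most [2/(m+1) + 2/(n+1)], hence at
     most [4/(m+1)]. *)
  have := zd m; have := zd n; rewrite /d -/a -/b.
  have : n.+1%:R^-1 <= m.+1%:R^-1 :> R by rewrite lef_pV2 ?posrE ?ltr0n// ler_nat.
  rewrite (_ : (2^-1) ^+ 2 = 4^-1 :> R); last by field.
  move: (`|p - a| ^+ 2) (`|p - b| ^+ 2) (ip _ _) (inf S) n.+1%:R^-1 => P Q I D N.
  by move: m.+1%:R^-1 => M; lra.
have cvg1 : cvgn (fun n => (z n).1).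
  apply: cvg_of_sqr_norm_le => m n /z_cauchy; apply: le_trans.
  by apply: le_trans (sqr_norm_le_sum hip mA (zA m) (zA n)); rewrite lerDl sqr_ge0.
have cvg2 : cvgn (fun n => (z n).2).
  apply: cvg_of_sqr_norm_le => m n /z_cauchy; apply: le_trans.
  by apply: le_trans (sqr_norm_le_sum hip mA (zA m) (zA n)); rewrite lerDr sqr_ge0.
move: cvg1 cvg2 => /cvg_ex[x xP] /cvg_ex[u uP].
(* The graph is closed: the monotonicity inequalities pass to the limit. *)
have Axu : A x u.
  apply: (maximally_monotone_mem hA) => y v yv.
  apply: (@cvgr_to_ge _ \oo _ _ (fun n => ip ((z n).1 - y) ((z n).2 - v))).
    by apply: (cvg_inner hip); apply: cvgB => //; exact: cvg_cst.
  by apply: nearW => n; exact: mA.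
have dxu : d (x, u) <= inf S.
  apply: (@ler_cvg_to _ \oo _ _ (d \o z) (fun n => inf S + n.+1%:R^-1)).
  - rewrite /d -hip; under eq_fun do rewrite /= -hip.
    apply: (cvg_inner hip); apply: cvgB; try exact: cvg_cst; exact: cvgD.
  - rewrite -[X in _ --> X]addr0; apply: cvgD; first exact: cvg_cst.
    exact: cvg_harmonic.
  - by apply: nearW => n; exact: (ltW (zd n)).
have [r rE] : exists r, p - (x + u) = r by eexists.
(* The line through [(x, u)] and [(y, v)] stays in the graph, and its residuals are [r - t *: k]
   with [k = (y + v) - (x + u)]. *)
have r_orth y v : A y v -> ip r ((y + v) - (x + u)) = 0.
  move=> yv; rewrite -rE; apply: (sqr_norm_min_orthogonal hip) => t.
  apply: (le_trans dxu).
  have := minS _ _ (affine_relation_comb hAaff t yv Axu).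
  rewrite /d /= addrACA -!scalerDr scalerBl scale1r.
  by rewrite [X in p - X]addrCA opprD addrA -scalerBr.
(* The pairing with [(y, v)] expands to [ip (x - y) (u - v) + |r|^2] plus a term that [r_orth]
   cancels. *)
have Ar : A (x + r) (u + r).
  apply: (maximally_monotone_mem hA) => y v yv.
  have := r_orth _ _ yv; have := mA _ _ _ _ Axu yv; have := sqr_ge0 `|r|.
  rewrite -(opprB (x + u)) (opprD y) addrACA -hip ![_ + r - _]addrAC.
  move: (x - y) (u - v) => a b.
  rewrite linearNr linearDl !linearDr /= (innerC ip a r); lra.
(* For the point [(x + r, u + r)], orthogonality reads [ip r (r + r) = 0]. *)
have r0 : r = 0.
  have := r_orth _ _ Ar; rewrite (addrACA x) [_ - (x + u)]addrC addKr linearDr /= -mulr2n hip.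
  by move=> /eqP; rewrite mulrn_eq0 /= sqrf_eq0 normr_eq0 => /eqP.
exists x; suff -> : p - x = u by [].
by move/eqP: rE; rewrite r0 subr_eq0 => /eqP ->; rewrite addrC addKr.
Qed.

(** At [x = gamma *: y + (1 - gamma) *: w], the argument of [A] is [y], and
    [x - w = gamma *: (y - w)] cancels the factor [gamma^-1]. *)
Lemma A_gamma_graph (R : realType) (X : lmodType R) (A : X -> set X) (w : X)
    (gamma : R) (hgamma : gamma != 0) (y v : X) :
  A y v <-> A_gamma A w gamma (gamma *: y + (1 - gamma) *: w)
                              (v + (1 - gamma) *: (y - w)).
Proof.
have yE : gamma^-1 *: (gamma *: y + (1 - gamma) *: w - (1 - gamma) *: w) = y.
  by rewrite addrK scalerA mulVf// scale1r.
have wE : (gamma^-1 * (1 - gamma)) *: (gamma *: y + (1 - gamma) *: w - w)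
    = (1 - gamma) *: (y - w).
  rewrite scalerBl scale1r addrCA addrAC subrr add0r -scalerBr scalerA.
  by rewrite mulrAC mulVf// mul1r.
rewrite /A_gamma /= yE wE; split; first by exists v.
by move=> [v' Av' /addIr <-].
Qed.

Theorem proposition2p1 (R : realType) (X : completeNormedModType R)
    (ip : {dot X for idfun}) (hip : induces_norm ip)
    (A : X -> set X) (hA : maximally_monotone ip A)
    (w : X) (gamma : R) (hgamma : 0 < gamma < 1)
    (hAaff : affine_relation A) :
  is_affine_map_op (resolvent (A_gamma A w gamma)) /\
  affine_relation (A_gamma A w gamma).
Proof.
have g0 : gamma != 0 by case/andP: hgamma => /lt0r_neq0.
pose phi y := gamma *: y + (1 - gamma) *: w.
pose psi (y v : X) := v + (1 - gamma) *: (y - w).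
have graphP y v : A y v <-> A_gamma A w gamma (phi y) (psi y v).
  exact: A_gamma_graph.
have phi_psi y v : phi y + psi y v = y + v.
  rewrite /phi /psi scalerBr addrACA [X in _ + X]addrC subrK addrAC.
  by rewrite -scalerDl addrC subrKC scale1r addrC.
have graph_ex x u : A_gamma A w gamma x u ->
    exists y v, [/\ A y v, x = phi y & u = psi y v].
  move=> xu; pose y := gamma^-1 *: (x - (1 - gamma) *: w).
  pose v := u - (1 - gamma) *: (y - w).
  have xE : x = phi y by rewrite /phi scalerA mulfV// scale1r subrK.
  have uE : u = psi y v by rewrite /psi subrK.
  by exists y, v; split=> //; apply/graphP; rewrite -xE -uE.
have phi_comb t y z :
    phi (t *: y + (1 - t) *: z) = t *: phi y + (1 - t) *: phi z.
  rewrite /phi !scalerDr addrACA -(scalerDl _ t) subrKC scale1r !scalerA.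
  by rewrite ![_ * gamma]mulrC.
have psi_comb t y v z s :
    psi (t *: y + (1 - t) *: z) (t *: v + (1 - t) *: s)
    = t *: psi y v + (1 - t) *: psi z s.
  rewrite /psi [in RHS]scalerDr [X in _ = _ + X]scalerDr addrACA; congr (_ + _).
  rewrite !scalerA ![_ * (1 - gamma)]mulrC -!scalerA -scalerDr; congr (_ *: _).
  by rewrite !scalerBr addrACA -opprD -(scalerDl w) subrKC scale1r.
split; last first.
  split.
    have [[[y v] Ayv] _] := hAaff.
    by exists (phi y, psi y v); apply/graphP.
  move=> t [x u] [x' u'] /graph_ex[y [v [Ayv /= -> ->]]].
  move=> /graph_ex[y' [v' [Ayv' /= -> ->]]]; rewrite /graph_of /=.
  by rewrite -phi_comb -psi_comb; apply/graphP; exact: affine_relation_comb.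
have [J JP] := choice (affine_minty hip hA hAaff).
(* Two points of the graph of [A] with equal sums coincide. *)
have J_uniq y v : A y v -> J (y + v) = y.
  move=> Ayv; have := sqr_norm_le_sum hip hA.1 Ayv (JP (y + v)).
  rewrite [J _ + _]addrC subrK subrr normr0 expr0n /= => le0.
  apply/esym/eqP; rewrite -subr_eq0 -normr_eq0 -sqrf_eq0 eq_le sqr_ge0 andbT.
  by apply: le_trans le0; rewrite lerDl sqr_ge0.
exists (phi \o J); split.
  (* Since [phi_psi] preserves sums, solving [x + u = p] in the graph of [A_gamma] amounts to
     solving [y + v = p] in that of [A]. *)
  move=> p; apply/seteqP; split=> [x [u /graph_ex[y [v [Ayv -> ->]]] <-]|_ ->] /=.
    by rewrite phi_psi J_uniq.
  exists (psi (J p) (p - J p)); first exact/graphP.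
  by rewrite phi_psi addrC subrK.
move=> p q t /=; rewrite -phi_comb; congr phi.
(* The combination of the graph points over [p] and [q] has sum [t *: p + (1 - t) *: q], so
   uniqueness identifies its first coordinate. *)
rewrite -(J_uniq _ _ (affine_relation_comb hAaff t (JP p) (JP q))).
by rewrite addrACA -!scalerDr ![J _ + _]addrC !subrK.
Qed.
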